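(* Let $(X,d)$ be a complete $b$-rectangular metric space with coefficient $s>1$ and let $T:X\to X$ be a $(\phi,F)$-Kannan-type $(\Im)$ contraction, i.e. there exist functions $F:(0,+\infty)\to\mathbb{R}$ and $\phi:(0,+\infty)\to(0,+\infty)$ satisfying conditions (i)--(iv) listed in the context such that for all $x,y\in X$ with $d(Tx,Ty)>0$, $$F\big(s^2d(Tx,Ty)\big)+\phi\big(d(x,y)\big)\le F\left(\frac{d(x,Tx)+d(y,Ty)}{2}\right).$$ Then $T$ has a unique fixed point.
   Context: A $b$-rectangular metric space with coefficient $s\ge 1$ is a nonempty set $X$ with a map $d:X\times X\to[0,+\infty)$ such that for all $x,y\in X$ and all distinct points $u,v\in X$, each distinct from $x$ and $y$: (1) $d(x,y)=0$ if and only if $x=y$; (2) $d(x,y)=d(y,x)$; (3) $d(x,y)\le s[d(x,u)+d(u,v)+d(v,y)]$. A sequence $(x_n)$ converges to $x$ if $d(x_n,x)\to 0$; it is Cauchy if $d(x_n,x_m)\to 0$ as $n,m\to\infty$; the space is complete if every Cauchy sequence converges to some point of $X$. Conditions on $F$ and $\phi$: (i) $F$ is strictly increasing; (ii) for each sequence $(x_n)$ of positive numbers, $\lim_{n\to\infty}x_n=0$ if and only if $\lim_{n\to\infty}F(x_n)=-\infty$; (iii) $\liminf_{u\to\alpha^+}\phi(u)>0$ for all $\alpha>0$; (iv) $F$ is continuous. Since $F$ is defined only on $(0,+\infty)$, the contraction inequality for a pair $x,y$ is understood to include that the argument of $F$ on the right-hand side is positive. *)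

(* Defs.v *)
From HB Require Import structures.
From mathcomp Require Import all_boot all_order all_algebra.
From mathcomp Require Import all_classical all_reals all_analysis.

Set Implicit Arguments.
Unset Strict Implicit.
Unset Printing Implicit Defensive.

Import Order.TTheory GRing.Theory Num.Theory.
Import numFieldNormedType.Exports.

Local Open Scope classical_set_scope.
Local Open Scope ring_scope.

(* The points u and v occur only in the rectangular inequality, so the first
   two metric axioms are required unconditionally. *)
Record b_rectangular_metric (R : realType) (X : Type) (s : R) (d : X -> X -> R)
    : Prop := BRectangularMetric {
  brm_inhabited : inhabited X ;
  brm_coef_ge1 : 1 <= s ;
  brm_ge0 : forall x y, 0 <= d x y ;
  brm_eq0 : forall x y, d x y = 0 <-> x = y ;
  brm_sym : forall x y, d x y = d y x ;
  brm_rect : forall x y u v,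
    u <> v -> u <> x -> u <> y -> v <> x -> v <> y ->
    d x y <= s * (d x u + d u v + d v y)
}.

(* A b-rectangular metric is in general not continuous and its balls need not
   be open, so convergence is defined directly from the distance. *)
Definition brm_converges (R : realType) (X : Type) (d : X -> X -> R)
    (x_ : nat -> X) (x : X) : Prop :=
  d (x_ n) x @[n --> \oo] --> (0 : R).

Definition brm_cauchy (R : realType) (X : Type) (d : X -> X -> R)
    (x_ : nat -> X) : Prop :=
  d (x_ nm.1) (x_ nm.2) @[nm --> (\oo, \oo)] --> (0 : R).

Definition brm_complete (R : realType) (X : Type) (d : X -> X -> R) : Prop :=
  forall x_ : nat -> X, brm_cauchy d x_ -> exists x, brm_converges d x_ x.

(* Functions on (0, +oo) are represented by total functions on R, of which
   only the values at positive reals are constrained or used. *)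
Record kannan_control (R : realType) (F phi : R -> R) : Prop := KannanControl {
  kc_phi_gt0 : forall t, 0 < t -> 0 < phi t ;
  kc_F_incr : forall t u, 0 < t -> t < u -> F t < F u ;
  kc_F_ninfty : forall x_ : nat -> R, (forall n, 0 < x_ n) ->
    (x_ n @[n --> \oo] --> (0 : R) <-> F (x_ n) @[n --> \oo] --> -oo) ;
  kc_phi_liminf : forall a, 0 < a ->
    (0 < limf_einf (fun u => (phi u)%:E) a^'+)%E ;
  kc_F_cont : {within `]0, +oo[, continuous F}
}.

(* The conjunct on positivity says that F is applied inside its domain; for
   the other arguments this follows from 0 < d (T x) (T y). *)
Definition phi_F_kannan_contraction (R : realType) (X : Type) (s : R)
    (d : X -> X -> R) (T : X -> X) : Prop :=
  exists F phi : R -> R, kannan_control F phi /\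
    forall x y, 0 < d (T x) (T y) ->
      0 < (d x (T x) + d y (T y)) / 2 /\
      F (s ^+ 2 * d (T x) (T y)) + phi (d x y) <=
        F ((d x (T x) + d y (T y)) / 2).

(* Main.v *)
(** Since phi is positive and F increasing, the contraction inequality yields
    Kannan's linear inequality d(Tx,Ty) <= a (d(x,Tx) + d(y,Ty)) with
    a = 1/(2s^2), so that a < 1/2 and s a < 1.  The first bound makes
    consecutive distances d_n along an orbit decay geometrically, and Kannan's
    inequality alone (without the rectangular one) bounds d(x_(n+1), x_(m+1))
    by a (d_n + d_m), so orbits are Cauchy.  The second bound shows that the
    limit z is fixed, via the rectangular inequality on z, x_n, x_(n+1), Tz. *)
Require Import Defs.
From mathcomp Require Import all_boot all_order all_algebra.
From mathcomp Require Import all_classical all_reals all_analysis.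
From mathcomp Require Import lra.
Import Order.TTheory GRing.Theory Num.Theory.
Import numFieldNormedType.Exports.
Local Open Scope ring_scope.
Local Open Scope classical_set_scope.

Definition kannan_contraction {R : realType} {X : Type} (a : R)
    (d : X -> X -> R) (T : X -> X) : Prop :=
  forall x y, d (T x) (T y) <= a * (d x (T x) + d y (T y)).

(** If [s ^+ 2 * d (T x) (T y)] exceeded the mean of [d x (T x)] and [d y (T y)], then [F] would be
    larger there, against [phi (d x y) > 0]. *)
Lemma phi_F_kannan_linear {R : realType} {X : Type} {s : R} {d : X -> X -> R}
    {T : X -> X} :
  b_rectangular_metric s d -> phi_F_kannan_contraction s d T ->
  kannan_contraction (2 * s ^+ 2)^-1 d T.
Proof.
move=> dm [F [phi [Fphi FT]]] x y.
have s_gt0 : 0 < s by exact: lt_le_trans ltr01 (brm_coef_ge1 dm).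
have s2_gt0 : 0 < s ^+ 2 by exact: exprn_gt0.
rewrite ler_pdivlMl ?mulr_gt0 //.
have := brm_ge0 dm (T x) (T y); rewrite le_eqVlt => /orP[/eqP<-|dT_gt0].
  by rewrite mulr0 addr_ge0 ?(brm_ge0 dm).
have [m_gt0 FTxy] := FT _ _ dT_gt0.
(* [phi] is known to be positive only at positive arguments. *)
have dxy_gt0 : 0 < d x y.
  rewrite lt0r (brm_ge0 dm) andbT; apply/eqP => /(brm_eq0 dm) xy.
  by move: dT_gt0; rewrite xy (brm_eq0 dm (T y) (T y)).2 // ltxx.
have phi_gt0 := kc_phi_gt0 Fphi dxy_gt0.
have [|m_lt] := leP (s ^+ 2 * d (T x) (T y)) ((d x (T x) + d y (T y)) / 2).
  by lra.
by have := kc_F_incr Fphi m_gt0 m_lt; lra.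
Qed.

(** On consecutive points, d_(n+1) <= a (d_n + d_(n+1)), so the steps shrink by the ratio a / (1 -
    a), which is below 1 as a < 1/2. *)
Lemma kannan_orbit_step_cvg0 {R : realType} {X : Type} {s a : R}
    {d : X -> X -> R} {T : X -> X} (x0 : X) :
  b_rectangular_metric s d -> 0 <= a -> a < 2^-1 ->
  kannan_contraction a d T ->
  d (iter n T x0) (iter n.+1 T x0) @[n --> \oo] --> (0 : R).
Proof.
move=> dm a_ge0 a_lt kannanT.
pose r := a / (1 - a).
have r_ge0 : 0 <= r by apply: divr_ge0; lra.
have r_lt1 : `|r| < 1 by rewrite ger0_norm // ltr_pdivrMr; lra.
apply: (@squeeze_cvgr _ _ _ _ (fun=> 0) (geometric (d x0 (T x0)) r)).
- apply: nearW => n; rewrite (brm_ge0 dm) /=.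
  elim: n => [|n IH]; first by rewrite mulr1.
  rewrite exprS mulrCA; apply: le_trans (ler_wpM2l r_ge0 IH).
  rewrite mulrAC ler_pdivlMr; last by lra.
  by have := kannanT (iter n T x0) (iter n.+1 T x0); rewrite /=; lra.
- exact: cvg_cst.
- exact: cvg_geometric.
Qed.

(** The orbit starts at [T x0] so that every term is an image under [T], as Kannan's inequality
    requires. *)
Lemma kannan_orbit_cauchy {R : realType} {X : Type} {s a : R}
    {d : X -> X -> R} {T : X -> X} (x0 : X) :
  b_rectangular_metric s d -> 0 <= a -> a < 2^-1 ->
  kannan_contraction a d T ->
  brm_cauchy d (fun n => iter n.+1 T x0).
Proof.
move=> dm a_ge0 a_lt kannanT.
pose c n := d (iter n T x0) (iter n.+1 T x0).
have c0 : c n @[n --> \oo] --> (0 : R).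
  exact: kannan_orbit_step_cvg0 dm a_ge0 a_lt kannanT.
apply: (@squeeze_cvgr _ _ _ _ (fun=> 0) (fun nm => a * (c nm.1 + c nm.2))).
- by apply: nearW => nm; rewrite (brm_ge0 dm) /=; exact: kannanT.
- exact: cvg_cst.
- rewrite -(mulr0 a) -[X in a * X](addr0 0).
  apply: cvgMr; apply: cvgD.
  + by apply: cvg_comp c0; exact: cvg_fst.
  + by apply: cvg_comp c0; exact: cvg_snd.
Qed.

Lemma kannan_fixpoint_unique {R : realType} {X : Type} {s a : R}
    {d : X -> X -> R} {T : X -> X} (x y : X) :
  b_rectangular_metric s d -> kannan_contraction a d T ->
  T x = x -> T y = y -> x = y.
Proof.
move=> dm kannanT Tx Ty; apply/(brm_eq0 dm)/eqP; rewrite eq_le (brm_ge0 dm) andbT.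
have := kannanT x y; rewrite Tx Ty.
by rewrite (brm_eq0 dm x x).2 // (brm_eq0 dm y y).2 // addr0 mulr0.
Qed.

Lemma kannan_fixpoint_exists {R : realType} {X : Type} {s a : R}
    {d : X -> X -> R} {T : X -> X} :
  b_rectangular_metric s d -> 0 <= a -> a < 2^-1 ->
  kannan_contraction a d T ->
  s * a < 1 -> brm_complete d -> exists x, T x = x.
Proof.
move=> dm a_ge0 a_lt kannanT sa_lt1 dc; apply: contrapT => /forallNP noFix.
have [x0] := brm_inhabited dm.
have [z zlim] := dc _ (kannan_orbit_cauchy x0 dm a_ge0 a_lt kannanT).
set D := d z (T z).
have D_gt0 : 0 < D.
  by rewrite lt0r (brm_ge0 dm) andbT; apply/eqP => /(brm_eq0 dm)/esym/noFix.
have s_ge1 := brm_coef_ge1 dm.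
have sa_ge0 : 0 <= s * a by rewrite mulr_ge0 //; lra.
(* The final estimate reads D (1 - s a) <= e (2 s + s a); the extra 1 in [k] makes it contradict
   [ek]. *)
pose k := s * 2 + s * a + 1.
have k_gt0 : 0 < k by rewrite /k; lra.
pose e := D * (1 - s * a) / k.
have e_gt0 : 0 < e by rewrite divr_gt0 // mulr_gt0 //; lra.
have ek : e * k = D * (1 - s * a) by rewrite /e divfK // gt_eqF.
have e_leD : e <= D by rewrite ler_pdivrMr // ler_pM2l // /k; lra.
have small (u : nat -> R) : (forall n, 0 <= u n) ->
    u n @[n --> \oo] --> (0 : R) ->
    exists N, forall n, (N <= n)%N -> u n < e.
  move=> u_ge0 /cvgrPdist_lt/(_ _ e_gt0)[N _ uN]; exists N => n /uN /=.
  by rewrite sub0r normrN ger0_norm.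
have [N zN] := small _ (fun=> brm_ge0 dm _ _) zlim.
have [M xM] := small _ (fun=> brm_ge0 dm _ _)
  (kannan_orbit_step_cvg0 x0 dm a_ge0 a_lt kannanT).
(* The rectangular inequality needs intermediate points distinct from [z] and [T z]. A coincidence
   with either would make a distance smaller than [e] equal to [D], but [e <= D]. *)
have far n : (N + M <= n)%N -> iter n.+1 T x0 <> z /\ iter n.+1 T x0 <> T z.
  move=> n_ge; split => xz.
  - have := xM n.+1 (leq_trans (leq_addl N M) (leqW n_ge)).
    by rewrite (iterS n.+1) xz ltNge e_leD.
  - have := zN n (leq_trans (leq_addr M N) n_ge).
    by rewrite xz (brm_sym dm) ltNge e_leD.
pose x n := iter n T x0; pose n := (N + M)%N.
have [x1z x1Tz] := far n (leqnn _).
have [x2z x2Tz] := far n.+1 (leqnSn _).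
(* Equal consecutive iterates would be a fixed point. *)
have x12 : x n.+1 <> x n.+2 by move=> /esym; exact: noFix.
have rect := brm_rect dm x12 x1z x1Tz x2z x2Tz.
have h1 : d z (x n.+1) < e by rewrite (brm_sym dm); apply: zN; exact: leq_addr.
have h2 : d (x n.+1) (x n.+2) < e by apply: xM; rewrite leqW // leq_addl.
have h3 : d (x n.+2) (T z) <= a * (e + D).
  by apply: le_trans (kannanT (x n.+1) z) _; rewrite ler_wpM2l // lerD2r ltW.
have : D <= s * (e + e + a * (e + D)).
  by apply: le_trans rect _; rewrite ler_wpM2l //; lra.
by move: ek; rewrite /k; lra.
Qed.

Theorem theorem3p7 (R : realType) (X : Type) (s : R) (d : X -> X -> R)
    (T : X -> X) :
  b_rectangular_metric s d -> 1 < s -> brm_complete d ->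
  phi_F_kannan_contraction s d T ->
  exists! x : X, T x = x.
Proof.
move=> dm s_gt1 dc FT.
have kannanT := phi_F_kannan_linear dm FT.
have s2_gt1 : 1 < s ^+ 2 by rewrite exprn_egt1.
have a_ge0 : 0 <= (2 * s ^+ 2)^-1 by rewrite invr_ge0; lra.
have a_lt : (2 * s ^+ 2)^-1 < 2^-1 by rewrite ltf_pV2 ?posrE; lra.
(* The left side is 1 / (2 s). *)
have sa_lt1 : s * (2 * s ^+ 2)^-1 < 1.
  by rewrite ltr_pdivrMr; [nra | lra].
have [z Tz] := kannan_fixpoint_exists dm a_ge0 a_lt kannanT sa_lt1 dc.
by exists z; split=> // y; exact: (kannan_fixpoint_unique _ _ dm kannanT).
Qed.
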